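(* Let $Q$ be a multiplicative semiopen quantal frame. Let $G$ be the involutive localic graph with multiplication associated to $Q$: $\mathcal O(G_1)=Q$, $\mathcal O(G_0)=R(Q)$, $d^*(z)=z$ and $r^*(z)=z^*$ for $z\in R(Q)$, $i^*(a)=a^*$ for $a\in Q$, $G_2=G_1\times_{G_0}G_1$ with $\mathcal O(G_2)=Q\otimes_{R(Q)}Q$, and $m:G_2\to G_1$ given by $m^*=(\mu_0)_*$, together with the map $u:G_0\to G_1$ defined by $u^*=\upsilon$. Then $G=(G_0,G_1,d,r,m,u,i)$ is a quantal groupoid. Furthermore, if $Q$ is open then $G$ is an open groupoid.
   Context: A sup-lattice is a complete lattice; homomorphisms of sup-lattices preserve all joins. A quantale is a sup-lattice with an associative multiplication preserving joins in each variable (not necessarily unital). It is involutive if it has a join-preserving map $a\mapsto a^*$ with $a^{**}=a$ and $(ab)^*=b^*a^*$. An involutive quantal frame is an involutive quantale whose underlying lattice is a frame; $1$ denotes its top element. $R(Q)=\{a\in Q: a1\le a\}$ is the set of right-sided elements, a subframe of $Q$. $Q$ is an $R(Q)$-$R(Q)$-bimodule via $z\cdot a=a\wedge z$ and $a\cdot z=a\wedge z^*$. The sup-lattice tensor product $Q\otimes_{R(Q)}Q$ (quotient of $Q\otimes Q$ by $(a\wedge z^* )\otimes b=a\otimes(z\wedge b)$) coincides with the frame pushout of $z\mapsto z^*$ and of the inclusion $z\mapsto z$, from $R(Q)$ to $Q$, so it is the frame of the pullback $G_2$ of $r$ (first factor) and $d$ (second factor). $Q$ is balanced if $b(a1\wedge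 c)=(b\wedge 1a^* )c$ for all $a,b,c\in Q$. If $Q$ is balanced and $R(Q)=Q1$, the quantale multiplication factors through a sup-lattice homomorphism $\mu_0:Q\otimes_{R(Q)}Q\to Q$, $\mu_0(a\otimes b)=ab$ (the reduced multiplication); $Q$ is multiplicative if it is balanced and the right adjoint $(\mu_0)_*$, $(\mu_0)_*(a)=\bigvee_{xy\le a}x\otimes y$, preserves joins. Put $\upsilon(a)=\bigvee_{xy^*\le a}x\wedge y$. A balanced quantal frame is semiopen if $\upsilon(Q)\subset R(Q)$ and $\bigvee_{xx^*x\le a}x=a$ for all $a\in Q$ (this implies $R(Q)=Q1$); it is open if, furthermore, $(a1\wedge b)c=a1\wedge bc$ for all $a,b,c\in Q$. For a locale $X$, $\mathcal O(X)$ is its frame; a map of locales $f$ has inverse image frame homomorphism $f^*$. $f$ is semiopen if $f^*$ has a left adjoint $f_!$, and open if also $f_!(f^*(b)\wedge a)=b\wedge f_!(a)$. A localic groupoid is an internal groupoid in the category of locales, with domain $d$, range $r$, multiplication $m:G_2\to G_1$ (composable pairs $(x,y)$ have $r(x)=d(y)$), units $u$, inversion $i$. It is quantal if $m$ is semiopen and open if $d$ is open. *)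

(* Defs.v *)
From HB Require Import structures.
From mathcomp Require Import all_boot all_order.
From mathcomp Require Import boolp classical_sets.

Set Implicit Arguments.
Unset Strict Implicit.
Unset Printing Implicit Defensive.

Import Order.TTheory.
Local Open Scope classical_set_scope.
Local Open Scope order_scope.

HB.mixin Record Lattice_hasSup d T of Order.TBLattice d T := {
  Sup : set T -> T;
  Sup_isLub : forall S : set T, isLub S (Sup S)
}.

#[short(type="supLatticeType")]
HB.structure Definition SupLattice d :=
  { T of Lattice_hasSup d T & Order.TBLattice d T }.

HB.mixin Record SupLattice_isFrame d T of SupLattice d T := {
  meet_Sup : forall (x : T) (S : set T),
    x `&` Sup S = Sup [set x `&` a | a in S]
}.

#[short(type="frameType")]
HB.structure Definition Frame d :=
  { T of SupLattice_isFrame d T & SupLattice d T }.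

HB.mixin Record SupLattice_isQuantale d T of SupLattice d T := {
  qmul : T -> T -> T;
  qmulA : associative qmul;
  qmul_Supl : forall (S : set T) (b : T),
    qmul (Sup S) b = Sup [set qmul a b | a in S];
  qmul_Supr : forall (a : T) (S : set T),
    qmul a (Sup S) = Sup [set qmul a b | b in S]
}.

#[short(type="quantaleType")]
HB.structure Definition Quantale d :=
  { T of SupLattice_isQuantale d T & SupLattice d T }.

HB.mixin Record Quantale_isInvolutive d T of Quantale d T := {
  qstar : T -> T;
  qstarK : involutive qstar;
  qstarM : forall a b : T, qstar (qmul a b) = qmul (qstar b) (qstar a);
  qstar_Sup : forall S : set T, qstar (Sup S) = Sup [set qstar a | a in S]
}.

#[short(type="invQuantaleType")]
HB.structure Definition InvQuantale d :=
  { T of Quantale_isInvolutive d T & Quantale d T }.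

#[short(type="invQuantalFrameType")]
HB.structure Definition InvQuantalFrame d :=
  { T of InvQuantale d T & Frame d T }.

Notation "a *q b" := (qmul a b) (at level 40, left associativity) : order_scope.

HB.factory Record POrder_isFrame d T of Order.POrder d T := {
  meet : T -> T -> T;
  Sup : set T -> T;
  meetP : forall x y z, (x <= meet y z) = (x <= y) && (x <= z);
  Sup_isLub : forall S : set T, isLub S (Sup S);
  meet_Sup : forall (x : T) (S : set T),
    meet x (Sup S) = Sup [set meet x a | a in S]
}.

HB.builders Context d T of POrder_isFrame d T.

Let join (x y : T) := Sup [set x; y].

Let joinP x y z : (join x y <= z) = (x <= z) && (y <= z).
Proof.
have [ub least] := Sup_isLub [set x; y].
apply/idP/andP => [h|[xz yz]].
  by split; apply: le_trans h; apply: ub; [left|right].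
by apply: least => t [] ->.
Qed.

HB.instance Definition _ :=
  Order.POrder_MeetJoin_isLattice.Build d T meetP joinP.

Let le0x x : Sup set0 <= x.
Proof. by apply: (Sup_isLub set0).2. Qed.

Let lex1 x : x <= Sup setT.
Proof. exact: (Sup_isLub setT).1. Qed.

HB.instance Definition _ := Order.hasBottom.Build d T le0x.
HB.instance Definition _ := Order.hasTop.Build d T lex1.
HB.instance Definition _ := Lattice_hasSup.Build d T Sup_isLub.
HB.instance Definition _ := SupLattice_isFrame.Build d T meet_Sup.

HB.end.

Section SupTheory.
Context {d : Order.disp_t} {L : supLatticeType d}.
Implicit Types (S : set L) (x : L).

Lemma Sup_ub S x : S x -> x <= Sup S.
Proof. exact: (Sup_isLub S).1. Qed.

Lemma Sup_le S x : (forall a, S a -> a <= x) -> Sup S <= x.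
Proof. exact: (Sup_isLub S).2. Qed.

Lemma Sup_leP S x : Sup S <= x <-> (forall a, S a -> a <= x).
Proof.
by split=> [h a Sa|/Sup_le//]; apply: le_trans h; apply: Sup_ub.
Qed.

Lemma le_eqP (x y : L) : (forall z, x <= z <-> y <= z) -> x = y.
Proof.
by move=> h; apply/le_anti/andP; split; apply/h.
Qed.

Lemma Sup_set2 (x y : L) : x <= y -> Sup [set x; y] = y.
Proof.
move=> xy; apply/le_anti/andP; split; last by apply: Sup_ub; right.
by apply: Sup_le => t [] ->.
Qed.

End SupTheory.

Definition sup_morphism d d' (L : supLatticeType d) (M : supLatticeType d')
    (f : L -> M) : Prop :=
  forall S : set L, f (Sup S) = Sup [set f a | a in S].

Definition is_left_adjoint d d' (L : supLatticeType d) (M : supLatticeType d')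
    (l : L -> M) (r : M -> L) : Prop :=
  forall a b, (l a <= b) = (a <= r b).

(* A right adjoint to f only when f preserves joins, see [radjP]. *)
Definition radj d d' (L : supLatticeType d) (M : supLatticeType d')
    (f : L -> M) (b : M) : L :=
  Sup [set a | f a <= b].

Section SupMorphismTheory.
Context {d d' : Order.disp_t} {L : supLatticeType d} {M : supLatticeType d'}.

Lemma sup_morphism_le (f : L -> M) : sup_morphism f -> {homo f : x y / x <= y}.
Proof.
move=> fS x y xy; rewrite -(Sup_set2 xy) fS; apply: Sup_ub.
by exists x => //; left.
Qed.

Lemma radjP (f : L -> M) : sup_morphism f -> is_left_adjoint f (radj f).
Proof.
move=> fS a b; apply/idP/idP => [fab|afb]; first exact: Sup_ub.
apply: le_trans (sup_morphism_le fS afb) _.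
by rewrite fS; apply: Sup_le => _ [x fx <-].
Qed.

Lemma left_adjoint_Sup (l : L -> M) (r : M -> L) :
  is_left_adjoint l r -> sup_morphism l.
Proof.
move=> lr S; apply: le_eqP => z; rewrite lr !Sup_leP; split=> h.
  by move=> _ [a Sa <-]; rewrite lr; apply: h.
by move=> a Sa; rewrite -lr; apply: h; exists a.
Qed.

Lemma right_adjointI (l : L -> M) (r : M -> L) : is_left_adjoint l r ->
  {morph r : x y / x `&` y}.
Proof.
move=> lr x y; apply/le_anti/andP; split.
  by rewrite lexI -!lr; apply/andP; split; rewrite (le_trans (y := x `&` y))
     ?lr ?leIl ?leIr.
by rewrite -lr lexI !lr leIl leIr.
Qed.

Lemma right_adjoint1 (l : L -> M) (r : M -> L) :
  is_left_adjoint l r -> r \top = \top.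
Proof. by move=> lr; apply/le_anti; rewrite lex1 -lr lex1. Qed.

End SupMorphismTheory.

Record frameHom d d' (A : frameType d) (B : frameType d') := FrameHom {
  fhom :> A -> B;
  fhom_Sup : sup_morphism fhom;
  fhomI : {morph fhom : x y / x `&` y};
  fhom1 : fhom \top = \top
}.

Lemma frameHom_eq d d' (A : frameType d) (B : frameType d')
  (f g : frameHom A B) : f =1 g -> f = g.
Proof.
case: f g => [f fS fI f1] [g gS gI g1] /= /funext fg.
by case: _ / fg gS gI g1 => gS gI g1; congr FrameHom; apply: Prop_irrelevance.
Qed.

Definition fhom_id d (A : frameType d) : frameHom A A.
Proof.
by exists id => // S; congr Sup; rewrite image_id.
Defined.

Definition fhom_comp d d' d'' (A : frameType d) (B : frameType d')
  (C : frameType d'') (g : frameHom B C) (f : frameHom A B) : frameHom A C.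
Proof.
exists (fun a => g (f a)).
- by move=> S; rewrite !fhom_Sup image_comp.
- by move=> x y; rewrite !fhomI.
- by rewrite !fhom1.
Defined.

(* A locale is represented by its frame of opens: [locmap X Y] is the type of
   maps of locales X -> Y. *)
Record locmap d d' (X : frameType d) (Y : frameType d') := LocMap {
  inv_im : frameHom Y X
}.

Lemma locmap_eq d d' (X : frameType d) (Y : frameType d')
  (f g : locmap X Y) : inv_im f =1 inv_im g -> f = g.
Proof. by case: f g => [f] [g] /= /frameHom_eq ->. Qed.

Definition loc_id d (X : frameType d) : locmap X X := LocMap (fhom_id X).

Definition loc_comp d d' d'' (X : frameType d) (Y : frameType d')
    (Z : frameType d'') (g : locmap Y Z) (f : locmap X Y) : locmap X Z :=
  LocMap (fhom_comp (inv_im f) (inv_im g)).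

Notation "g \oL f" := (loc_comp g f) (at level 50, left associativity).

Lemma loc_compA d1 d2 d3 d4 (X : frameType d1) (Y : frameType d2)
  (Z : frameType d3) (W : frameType d4)
  (h : locmap Z W) (g : locmap Y Z) (f : locmap X Y) :
  h \oL (g \oL f) = h \oL g \oL f.
Proof. exact: locmap_eq. Qed.

Lemma loc_compf1 d1 d2 (X : frameType d1) (Y : frameType d2)
  (f : locmap X Y) : f \oL loc_id X = f.
Proof. exact: locmap_eq. Qed.

Lemma loc_comp1f d1 d2 (X : frameType d1) (Y : frameType d2)
  (f : locmap X Y) : loc_id Y \oL f = f.
Proof. exact: locmap_eq. Qed.

Definition loc_semiopen d d' (X : frameType d) (Y : frameType d')
    (f : locmap X Y) : Prop :=
  exists f_ : X -> Y, is_left_adjoint f_ (inv_im f).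

Definition loc_open d d' (X : frameType d) (Y : frameType d')
    (f : locmap X Y) : Prop :=
  exists f_ : X -> Y, is_left_adjoint f_ (inv_im f) /\
    forall (a : X) (b : Y), f_ (inv_im f b `&` a) = b `&` f_ a.

(* For f : Z -> A and g : Z -> B, [tensor f g] is the quotient of the
   sup-lattice tensor product of A and B by the relations
   (a `&` f z) (x) b = a (x) (g z `&` b).  An element of this quotient is
   encoded by the set of the (a, b) such that a (x) b lies below it; the sets
   arising in this way are those saturated for the relations that define the
   tensor product, i.e. those satisfying [tensor_ideal].  The universal
   property among sup-lattices is [tensor_lift_Sup], [tensor_lift_pure] and
   [tensor_lift_unique]; [tensor f g] is also the frame pushout of f and g,
   i.e. the pullback of locales, see [pr1_pair], [pr2_pair], [pb_unique]. *)
Definition tensor_ideal dZ dA dB (Z : frameType dZ) (A : frameType dA)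
    (B : frameType dB) (f : frameHom Z A) (g : frameHom Z B)
    (U : set (A * B)) : Prop :=
  [/\ forall S b, U (Sup S, b) <-> (forall a, S a -> U (a, b)),
      forall a S, U (a, Sup S) <-> (forall b, S b -> U (a, b)) &
      forall a z b, U (a `&` f z, b) <-> U (a, g z `&` b)].

Record tensor dZ dA dB (Z : frameType dZ) (A : frameType dA)
    (B : frameType dB) (f : frameHom Z A) (g : frameHom Z B) := Tensor {
  tset : set (A * B);
  tsetP : tensor_ideal f g tset
}.

Section TensorFrame.
Context {dZ dA dB : Order.disp_t} {Z : frameType dZ} {A : frameType dA}.
Context {B : frameType dB} (f : frameHom Z A) (g : frameHom Z B).
Local Notation T := (tensor f g).
Implicit Types (U V W : T) (X : set (A * B)) (a : A) (b : B).

Lemma tensor_eq U V : tset U = tset V -> U = V.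
Proof.
case: U V => [U hU] [V hV] /= UV; case: _ / UV hV => hV.
by congr Tensor; apply: Prop_irrelevance.
Qed.

HB.instance Definition _ := gen_eqMixin T.
HB.instance Definition _ := gen_choiceMixin T.

Let tle U V := `[< tset U `<=` tset V >].

Let tle_refl : reflexive tle.
Proof. by move=> U; apply/asboolP. Qed.

Let tle_anti : antisymmetric tle.
Proof.
by move=> U V /andP[/asboolP UV /asboolP VU]; apply/tensor_eq/seteqP.
Qed.

Let tle_trans : transitive tle.
Proof.
move=> V U W /asboolP UV /asboolP VW; apply/asboolP.
exact: subset_trans UV VW.
Qed.

HB.instance Definition _ :=
  Order.Le_isPOrder.Build dA T tle_refl tle_anti tle_trans.

Lemma tensor_leP U V : U <= V <-> tset U `<=` tset V.
Proof. by split=> [/asboolP|h]//; apply/asboolP. Qed.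

Lemma tset_down U a b a' b' :
  a' <= a -> b' <= b -> tset U (a, b) -> tset U (a', b').
Proof.
case: (tsetP U) => hA hB _ aa bb; rewrite -{1}(Sup_set2 aa) -{1}(Sup_set2 bb).
by move=> /hA /(_ a' (or_introl erefl)) /hB /(_ b' (or_introl erefl)).
Qed.

Lemma tensor_ideal_shift U a b :
  tensor_ideal f g [set p | tset U (a `&` p.1, b `&` p.2)].
Proof.
case: (tsetP U) => hA hB hZ; split=> /=.
- move=> S y; rewrite meet_Sup; split.
    by move=> /hA h x Sx; apply: h; exists x.
  by move=> h; apply/hA => _ [x Sx <-]; apply: h.
- move=> x S; rewrite meet_Sup; split.
    by move=> /hB h y Sy; apply: h; exists y.
  by move=> h; apply/hB => _ [y Sy <-]; apply: h.
- by move=> x z y; rewrite meetA (meetCA b); apply: hZ.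
Qed.

Lemma tensor_ideal_bigcap (F : set (set (A * B))) :
  (forall X, F X -> tensor_ideal f g X) -> tensor_ideal f g (\bigcap_(X in F) X).
Proof.
move=> hF; split.
- move=> S b; split=> [h a Sa X FX|h X FX].
    by case: (hF X FX) => hA _ _; apply: (hA S b).1 (h X FX) a Sa.
  by case: (hF X FX) => hA _ _; apply/hA => a Sa; apply: h.
- move=> a S; split=> [h b Sb X FX|h X FX].
    by case: (hF X FX) => _ hB _; apply: (hB a S).1 (h X FX) b Sb.
  by case: (hF X FX) => _ hB _; apply/hB => b Sb; apply: h.
- move=> a z b; split=> h X FX; case: (hF X FX) => _ _ hZ.
    exact: (hZ a z b).1 (h X FX).
  exact: (hZ a z b).2 (h X FX).
Qed.

Definition tspan X : T := @Tensor _ _ _ _ _ _ f g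
  (\bigcap_(Y in [set Y | tensor_ideal f g Y /\ X `<=` Y]) Y)
  (tensor_ideal_bigcap (fun Y hY => proj1 hY)).

Lemma tspan_leP X U : tspan X <= U <-> X `<=` tset U.
Proof.
rewrite tensor_leP; split=> [h p Xp|h p]; first by apply: h => Y [_]; apply.
by apply; split=> //; apply: tsetP.
Qed.

Lemma tensor_idealI U V : tensor_ideal f g (tset U `&` tset V)%classic.
Proof.
have [hA hB hZ] := tsetP U; have [hA' hB' hZ'] := tsetP V; split=> /=.
- move=> S b; split=> [[/hA h /hA' h'] a Sa|h]; first by split; [exact: h|exact: h'].
  by split; [apply/hA|apply/hA'] => a /h[].
- move=> a S; split=> [[/hB h /hB' h'] b Sb|h]; first by split; [exact: h|exact: h'].
  by split; [apply/hB|apply/hB'] => b /h[].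
- by move=> a z b; split=> -[/hZ h /hZ' h'].
Qed.

Let tmeet U V : T := Tensor (tensor_idealI U V).

Let tmeetP U V W : (U <= tmeet V W) = (U <= V) && (U <= W).
Proof.
apply/idP/andP => [/tensor_leP h|[/tensor_leP UV /tensor_leP UW]].
  by split; apply/tensor_leP => p /h[].
by apply/tensor_leP => p Up; split; [apply: UV|apply: UW].
Qed.

Let tSup (F : set T) : T := tspan (\bigcup_(U in F) tset U).

Let tSup_isLub F : isLub F (tSup F).
Proof.
have E V : tSup F <= V <-> ubound F V.
  rewrite tspan_leP; split=> [h U FU|h p [U FU Up]].
    by apply/tensor_leP => p Up; apply: h; exists U.
  by have /tensor_leP := h U FU; apply.
by split=> [|V /E//]; apply/E.
Qed.

Let tmeet_Sup U (F : set T) : tmeet U (tSup F) = tSup [set tmeet U V | V in F].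
Proof.
apply/le_anti/andP; split; last first.
  apply: (tSup_isLub _).2 => _ [V FV <-]; rewrite tmeetP; apply/andP; split.
    by apply/tensor_leP => p [].
  apply: (@le_trans _ _ V).
    by apply/tensor_leP => p [].
  exact: (tSup_isLub F).1.
apply/tensor_leP => -[x y] [Uxy hF]; pose W := tSup [set tmeet U V | V in F].
change (tset W (x, y)).
suff : tensor_ideal f g [set p | tset W (x `&` p.1, y `&` p.2)] /\
    \bigcup_(V in F) tset V `<=` [set p | tset W (x `&` p.1, y `&` p.2)].
  by move=> /hF H; move: (H : tset W (x `&` x, y `&` y)); rewrite !meetxx.
split; first exact: tensor_ideal_shift.
move=> [u v] [V FV Vuv] /=.
have /tensor_leP : tmeet U V <= W by apply: (tSup_isLub _).1; exists V.
apply; split.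
  by apply: tset_down Uxy; apply: leIl.
by apply: tset_down Vuv; apply: leIr.
Qed.

HB.instance Definition _ := POrder_isFrame.Build dA T tmeetP tSup_isLub tmeet_Sup.

Lemma tsetI U V : tset (U `&` V) = (tset U `&` tset V)%classic.
Proof. by []. Qed.

Lemma tset1 : tset (\top : T) = setT.
Proof.
have hT : tensor_ideal f g setT by [].
apply/seteqP; split=> // p _.
by have /tensor_leP/(_ p) : Tensor hT <= (\top : T) := lex1 _; apply.
Qed.

Definition pure a b : T := tspan [set (a, b)].

Lemma pure_leP a b U : pure a b <= U <-> tset U (a, b).
Proof. by rewrite tspan_leP; split=> [h|h p ->//]; apply: h. Qed.


Lemma pure_Supl S b : pure (Sup S) b = Sup [set pure a b | a in S].
Proof.
apply: le_eqP => U; rewrite pure_leP Sup_leP; case: (tsetP U) => hA _ _.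
split=> [/hA h _ [a Sa <-]|h]; first exact/pure_leP/h.
by apply/hA => a Sa; apply/pure_leP/h; exists a.
Qed.

Lemma pure_Supr a S : pure a (Sup S) = Sup [set pure a b | b in S].
Proof.
apply: le_eqP => U; rewrite pure_leP Sup_leP; case: (tsetP U) => _ hB _.
split=> [/hB h _ [b Sb <-]|h]; first exact/pure_leP/h.
by apply/hB => b Sb; apply/pure_leP/h; exists b.
Qed.

Lemma pure_balanced a z b : pure (a `&` f z) b = pure a (g z `&` b).
Proof.
apply: le_eqP => U; case: (tsetP U) => _ _ /(_ a z b) [h h'].
by split=> /pure_leP H; apply/pure_leP; [apply: h|apply: h'].
Qed.

Lemma pureI a b a' b' : pure (a `&` a') (b `&` b') = pure a b `&` pure a' b'.
Proof.
apply/le_anti/andP; split.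
  apply/pure_leP; split.
    apply: (@tset_down _ a b); rewrite ?leIl//.
    by apply/pure_leP; apply: lexx.
  apply: (@tset_down _ a' b'); rewrite ?leIr//.
  by apply/pure_leP; apply: lexx.
set W := pure (a `&` a') _; apply/tensor_leP => -[x y] [h h'].
pose U := Tensor (tensor_ideal_shift W a b).
have Wxy : tset W (a `&` x, b `&` y).
  have : pure a' b' <= U.
    apply/pure_leP; change (tset W (a `&` a', b `&` b')).
    by apply/pure_leP; apply: lexx.
  by move/tensor_leP => /(_ _ h').
pose V := Tensor (tensor_ideal_shift W x y).
have Vab : pure a b <= V.
  apply/pure_leP; change (tset W (x `&` a, y `&` b)).
  by rewrite meetC [y `&` b]meetC.
move/tensor_leP: Vab => /(_ _ h) Vxy.
by move: (Vxy : tset W (x `&` x, y `&` y)); rewrite !meetxx.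
Qed.

Lemma pure11 : pure \top \top = \top.
Proof.
apply/le_anti/andP; split; first exact: lex1.
apply/tensor_leP => -[x y] _.
apply: (@tset_down _ \top \top); rewrite ?lex1//.
by apply/pure_leP; apply: lexx.
Qed.

Section Lift.
Context {dL : Order.disp_t} {L : supLatticeType dL} (h : A -> B -> L).

Definition balanced_bimorphism : Prop :=
  [/\ forall S b, h (Sup S) b = Sup [set h a b | a in S],
      forall a S, h a (Sup S) = Sup [set h a b | b in S] &
      forall a z b, h (a `&` f z) b = h a (g z `&` b)].

Definition tensor_lift (U : T) : L := Sup [set h p.1 p.2 | p in tset U].

Hypothesis hbal : balanced_bimorphism.

Lemma tensor_lift_ideal x : tensor_ideal f g [set p | h p.1 p.2 <= x].
Proof.
have [hA hB hZ] := hbal; split=> /=.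
- move=> S b; rewrite hA Sup_leP; split=> [H a Sa|H _ [a Sa <-]].
    by apply: H; exists a.
  exact: H.
- move=> a S; rewrite hB Sup_leP; split=> [H b Sb|H _ [b Sb <-]].
    by apply: H; exists b.
  exact: H.
- by move=> a z b; rewrite hZ.
Qed.

Lemma tensor_liftP :
  is_left_adjoint tensor_lift (fun x => Tensor (tensor_lift_ideal x)).
Proof.
move=> U x; apply/idP/idP => [/Sup_leP H|/tensor_leP H].
  by apply/tensor_leP => p Up; apply: H; exists p.
by apply: Sup_le => _ [p Up <-]; apply: H.
Qed.

Lemma tensor_lift_Sup : sup_morphism tensor_lift.
Proof. exact: left_adjoint_Sup tensor_liftP. Qed.

Lemma tensor_lift_pure a b : tensor_lift (pure a b) = h a b.
Proof.
apply: le_eqP => x; rewrite tensor_liftP.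
exact: (pure_leP a b (Tensor (tensor_lift_ideal x))).
Qed.

End Lift.

Lemma tensor_Sup_pure U : U = Sup [set pure p.1 p.2 | p in tset U].
Proof.
apply: le_eqP => V; rewrite Sup_leP tensor_leP.
split=> [UV _ [[a b] Up <-]|H [a b] Up]; first by apply/pure_leP/UV.
by apply/pure_leP/H; exists (a, b).
Qed.

Lemma tensor_lift_unique dL (L : supLatticeType dL) (k l : T -> L) :
  sup_morphism k -> sup_morphism l ->
  (forall a b, k (pure a b) = l (pure a b)) -> k =1 l.
Proof.
move=> kS lS kl U; rewrite (tensor_Sup_pure U) kS lS !image_comp /=.
by congr Sup; apply: eq_imagel => p _ /=; apply: kl.
Qed.

Definition tensor_inl : frameHom A T.
Proof.
exists (fun a => pure a \top).
- by move=> S; apply: pure_Supl.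
- by move=> a a'; rewrite -pureI meetxx.
- exact: pure11.
Defined.

Definition tensor_inr : frameHom B T.
Proof.
exists (fun b => pure \top b).
- by move=> S; apply: pure_Supr.
- by move=> b b'; rewrite -pureI meetxx.
- exact: pure11.
Defined.

Section Copair.
Context {dX : Order.disp_t} {X : frameType dX}.
Context (p : frameHom A X) (q : frameHom B X).
Hypothesis pq : forall z, p (f z) = q (g z).

Lemma copair_balanced : balanced_bimorphism (fun a b => p a `&` q b).
Proof.
split.
- move=> S b; rewrite fhom_Sup meetC meet_Sup image_comp.
  by congr Sup; apply: eq_imagel => a _ /=; rewrite meetC.
- by move=> a S; rewrite fhom_Sup meet_Sup image_comp.
- by move=> a z b; rewrite !fhomI pq meetA.
Qed.

Definition tensor_copair : frameHom T X.
Proof.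
exists (tensor_lift (fun a b => p a `&` q b)).
- exact: tensor_lift_Sup copair_balanced.
- move=> U V; apply/le_anti/andP; split.
    have mono := sup_morphism_le (tensor_lift_Sup copair_balanced).
    by rewrite lexI !mono ?leIl ?leIr.
  rewrite meet_Sup; apply: Sup_le => _ [_ [[a b] Vab <-] <-] /=.
  rewrite meetC meet_Sup; apply: Sup_le => _ [_ [[a' b'] Uab <-] <-] /=.
  rewrite meetACA -!fhomI; apply: Sup_ub; exists (a `&` a', b `&` b') => //=.
  split.
    by apply: tset_down Uab; apply: leIr.
  by apply: tset_down Vab; apply: leIl.
- apply/le_anti; rewrite lex1 /=; apply: Sup_ub.
  by exists (\top, \top); [rewrite tset1|rewrite /= !fhom1 meetxx].
Defined.

End Copair.

End TensorFrame.

Notation pullback f g := (tensor (inv_im f) (inv_im g)).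

Section Pullback.
Context {dX dY dZ : Order.disp_t} {X : frameType dX} {Y : frameType dY}.
Context {Z : frameType dZ} (f : locmap X Z) (g : locmap Y Z).

Definition pr1 : locmap (pullback f g) X :=
  LocMap (tensor_inl (inv_im f) (inv_im g)).
Definition pr2 : locmap (pullback f g) Y :=
  LocMap (tensor_inr (inv_im f) (inv_im g)).

Lemma pullback_sq : f \oL pr1 = g \oL pr2.
Proof.
apply: locmap_eq => z /=.
by rewrite -{1}[inv_im f z]meet1x pure_balanced meetx1.
Qed.

Section Pair.
Context {dW : Order.disp_t} {W : frameType dW}.
Context (p : locmap W X) (q : locmap W Y) (pq : f \oL p = g \oL q).

Lemma pb_pair_subproof z :
  inv_im p (inv_im f z) = inv_im q (inv_im g z).
Proof. exact: (congr1 (fun k : locmap W Z => inv_im k z) pq). Qed.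

Definition pb_pair : locmap W (pullback f g) :=
  LocMap (tensor_copair pb_pair_subproof).

Lemma pr1_pair : pr1 \oL pb_pair = p.
Proof.
apply: locmap_eq => a /=.
rewrite tensor_lift_pure ?fhom1 ?meetx1//.
exact: copair_balanced pb_pair_subproof.
Qed.

Lemma pr2_pair : pr2 \oL pb_pair = q.
Proof.
apply: locmap_eq => a /=.
rewrite tensor_lift_pure ?fhom1 ?meet1x//.
exact: copair_balanced pb_pair_subproof.
Qed.

End Pair.

Lemma pb_unique dW (W : frameType dW) (k l : locmap W (pullback f g)) :
  pr1 \oL k = pr1 \oL l -> pr2 \oL k = pr2 \oL l -> k = l.
Proof.
move=> e1 e2; apply: locmap_eq.
apply: tensor_lift_unique => [||a b]; [exact: fhom_Sup..|].
rewrite -[a]meetx1 -[b]meet1x pureI !fhomI.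
congr (_ `&` _).
  exact: (congr1 (fun k : locmap W X => inv_im k a) e1).
exact: (congr1 (fun k : locmap W Y => inv_im k b) e2).
Qed.

End Pullback.

Arguments pr1 {dX dY dZ X Y Z f g}.
Arguments pr2 {dX dY dZ X Y Z f g}.

Record locGraph := LocGraph {
  disp0 : Order.disp_t;
  disp1 : Order.disp_t;
  G0 : frameType disp0;
  G1 : frameType disp1;
  gdom : locmap G1 G0;
  gran : locmap G1 G0;
  gmul : locmap (pullback gran gdom) G1;
  gunit : locmap G0 G1;
  ginv : locmap G1 G1
}.

Section Groupoid.
Variable G : locGraph.
Local Notation d := (gdom G).
Local Notation r := (gran G).
Local Notation m := (gmul G).
Local Notation u := (gunit G).
Local Notation i := (ginv G).

Local Notation G2 := (pullback r d).
Local Notation G3 := (pullback (r \oL (pr2 : locmap G2 (G1 G))) d).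

Definition fst3 : locmap G3 G2 := pr1.
Definition trd3 : locmap G3 (G1 G) := pr2.

Section Maps.
Hypothesis (dm : d \oL m = d \oL pr1) (rm : r \oL m = r \oL pr2).
Hypothesis (du : d \oL u = loc_id _) (ru : r \oL u = loc_id _).
Hypothesis (di : d \oL i = r) (ri : r \oL i = d).

Lemma mulx1_compat : r \oL (m \oL fst3) = d \oL trd3.
Proof. by rewrite loc_compA rm pullback_sq. Qed.

Lemma assoc_compat : r \oL (pr2 \oL fst3) = d \oL trd3.
Proof. by rewrite loc_compA pullback_sq. Qed.

(* (x, y, z) |-> (y, z) *)
Definition snd3 : locmap G3 G2 := pb_pair assoc_compat.

Lemma x1mul_compat : r \oL (pr1 \oL fst3) = d \oL (m \oL snd3).
Proof.
by rewrite !loc_compA dm pullback_sq -!loc_compA pr1_pair.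
Qed.

Lemma unitl_compat : r \oL (u \oL d) = d \oL loc_id _.
Proof. by rewrite loc_compA ru loc_comp1f loc_compf1. Qed.

Lemma unitr_compat : r \oL loc_id _ = d \oL (u \oL r).
Proof. by rewrite loc_compA du loc_comp1f loc_compf1. Qed.

Lemma invr_compat : r \oL loc_id _ = d \oL i.
Proof. by rewrite di loc_compf1. Qed.

Lemma invl_compat : r \oL i = d \oL loc_id _.
Proof. by rewrite ri loc_compf1. Qed.

End Maps.

(* With generalized elements: (xy)z = x(yz), u(d(x)) x = x = x u(r(x)),
   x i(x) = u(d(x)) and i(x) x = u(r(x)). *)
Record localic_groupoid : Prop := LocalicGroupoid {
  lg_dm : d \oL m = d \oL pr1;
  lg_rm : r \oL m = r \oL pr2;
  lg_du : d \oL u = loc_id _;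
  lg_ru : r \oL u = loc_id _;
  lg_di : d \oL i = r;
  lg_ri : r \oL i = d;
  lg_assoc : m \oL pb_pair (mulx1_compat lg_rm)
           = m \oL pb_pair (x1mul_compat lg_dm);
  lg_unitl : m \oL pb_pair (unitl_compat lg_ru) = loc_id _;
  lg_unitr : m \oL pb_pair (unitr_compat lg_du) = loc_id _;
  lg_invr : m \oL pb_pair (invr_compat lg_di) = u \oL d;
  lg_invl : m \oL pb_pair (invl_compat lg_ri) = u \oL r
}.

Definition quantal_groupoid : Prop := localic_groupoid /\ loc_semiopen m.

Definition open_groupoid : Prop := localic_groupoid /\ loc_open d.

End Groupoid.

Section QuantalFrame.
Context {dQ : Order.disp_t} (Q : invQuantalFrameType dQ).
Implicit Types a b c x y : Q.

Lemma qmul_le a a' b b' : a <= a' -> b <= b' -> a *q b <= a' *q b'.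
Proof.
move=> aa bb; apply: (@le_trans _ _ (a' *q b)).
  rewrite -(Sup_set2 aa) qmul_Supl; apply: Sup_ub.
  by exists a => //; left.
rewrite -(Sup_set2 bb) qmul_Supr; apply: Sup_ub.
by exists b => //; left.
Qed.

Lemma qstar_adj : is_left_adjoint (@qstar _ Q) qstar.
Proof.
have mono : {homo @qstar _ Q : x y / x <= y}.
  by apply: sup_morphism_le => S; apply: qstar_Sup.
by move=> a b; apply/idP/idP => /mono; rewrite qstarK.
Qed.

Definition qstar_fhom : frameHom Q Q.
Proof.
exists qstar.
- exact: qstar_Sup.
- exact: right_adjointI qstar_adj.
- exact: right_adjoint1 qstar_adj.
Defined.

Record rsided := RSided { rsval :> Q; rsvalP : rsval *q \top <= rsval }.

HB.instance Definition _ := [isSub for rsval].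
HB.instance Definition _ := [Choice of rsided by <:].
HB.instance Definition _ := [SubChoice_isSubPOrder of rsided by <: with dQ].

Lemma rs_meet_subproof (z w : rsided) :
  (rsval z `&` rsval w) *q \top <= rsval z `&` rsval w.
Proof.
by rewrite lexI (le_trans (qmul_le (leIl _ _) (lexx _)) (rsvalP z))
  (le_trans (qmul_le (leIr _ _) (lexx _)) (rsvalP w)).
Qed.

Lemma rs_Sup_subproof (S : set rsided) :
  Sup (rsval @` S) *q \top <= Sup (rsval @` S).
Proof.
rewrite qmul_Supl; apply: Sup_le => _ [_ [z Sz <-] <-].
by apply: le_trans (rsvalP z) _; apply: Sup_ub; exists z.
Qed.

Let rmeet z w := RSided (rs_meet_subproof z w).
Let rSup S := RSided (rs_Sup_subproof S).

Let rmeetP (u v w : rsided) : (u <= rmeet v w) = (u <= v) && (u <= w).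
Proof. exact: lexI. Qed.

Let rSup_isLub S : isLub S (rSup S).
Proof.
split=> [z Sz|w hw]; first by apply: Sup_ub; exists z.
by apply: Sup_le => _ [z Sz <-]; apply: hw.
Qed.

Let rmeet_Sup (z : rsided) (S : set rsided) : rmeet z (rSup S) = rSup [set rmeet z w | w in S].
Proof.
apply: val_inj => /=; rewrite meet_Sup !image_comp.
by congr Sup.
Qed.

HB.instance Definition _ :=
  POrder_isFrame.Build dQ rsided rmeetP rSup_isLub rmeet_Sup.

Lemma rs_le (z w : rsided) : (z <= w) = (rsval z <= rsval w).
Proof. by []. Qed.

Definition rs_incl : frameHom rsided Q.
Proof.
exists rsval => //.
have top_rs : (\top : Q) *q \top <= \top by apply: lex1.
apply/le_anti; rewrite lex1 /=.
have : RSided top_rs <= \top by apply: lex1.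
by [].
Defined.

Definition rs_star : frameHom rsided Q := fhom_comp qstar_fhom rs_incl.

Definition balanced : Prop :=
  forall a b c, b *q ((a *q \top) `&` c) = (b `&` (\top *q qstar a)) *q c.

Local Notation QQ := (tensor rs_star rs_incl).

(* Well behaved only when the multiplication is balanced over [rsided], which
   [semiopen] ensures: see [qmul_balanced], [mu0_Sup] and [mu0_pure]. *)
Definition mu0 : QQ -> Q := tensor_lift qmul.

Definition multiplicative : Prop := balanced /\ sup_morphism (radj mu0).

Definition upsilon a : Q :=
  Sup [set p.1 `&` p.2 | p in [set p : Q * Q | p.1 *q qstar p.2 <= a]].

Definition semiopen : Prop :=
  [/\ balanced,
      forall a, upsilon a *q \top <= upsilon a &
      forall a, Sup [set x | x *q qstar x *q x <= a] = a].

Definition qopen : Prop :=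
  semiopen /\ forall a b c, ((a *q \top) `&` b) *q c = (a *q \top) `&` (b *q c).

Lemma mulr_le_semiopen a : semiopen -> a <= a *q qstar a *q a.
Proof. by case=> _ _ h; rewrite -[X in _ <= X]h; apply: Sup_ub => /=. Qed.

Lemma semiopen_rsided (z : rsided) : semiopen -> rsval z = rsval z *q \top.
Proof.
move=> Qs; apply/le_anti/andP; split; last exact: rsvalP.
apply: le_trans (mulr_le_semiopen _ Qs) _.
by rewrite -qmulA; apply: qmul_le; rewrite ?lex1.
Qed.

Lemma qmul_balanced : semiopen -> balanced_bimorphism rs_star rs_incl qmul.
Proof.
move=> Qs; split=> [S b|a S|a z b]; [exact: qmul_Supl|exact: qmul_Supr|].
have [bal _ _] := Qs.
rewrite /= (semiopen_rsided z Qs) bal qstarM.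
by rewrite (fhom1 qstar_fhom : qstar \top = \top).
Qed.

Lemma mu0_Sup : semiopen -> sup_morphism mu0.
Proof. by move=> Qs; apply: tensor_lift_Sup (qmul_balanced Qs). Qed.

Lemma mu0_pure a b : semiopen -> mu0 (pure _ _ a b) = a *q b.
Proof. by move=> Qs; apply: tensor_lift_pure (qmul_balanced Qs) _ _. Qed.

Lemma radj_mu0E a : semiopen ->
  radj mu0 a =
  Sup [set pure _ _ p.1 p.2 | p in [set p : Q * Q | p.1 *q p.2 <= a]].
Proof.
move=> Qs; apply/le_anti/andP; split; last first.
  apply: Sup_le => _ [[x y] /= xy <-].
  by rewrite -(radjP (mu0_Sup Qs)) (mu0_pure _ _ Qs).
rewrite (tensor_Sup_pure (radj mu0 a)); apply: Sup_le => _ [[x y] /pure_leP xy <-].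
apply: Sup_ub; exists (x, y) => //=.
by rewrite -(mu0_pure _ _ Qs) (radjP (mu0_Sup Qs)).
Qed.

Lemma upsilon_subproof (z : rsided) : fhom_id Q (rs_star z) = qstar_fhom (rs_incl z).
Proof. by []. Qed.

Lemma upsilonE a : semiopen ->
  upsilon a = tensor_copair upsilon_subproof (radj mu0 a).
Proof.
move=> Qs; rewrite radj_mu0E // fhom_Sup /upsilon image_comp.
have pureE x y : tensor_copair upsilon_subproof (pure _ _ x y) = x `&` qstar y.
  exact: tensor_lift_pure (copair_balanced upsilon_subproof) x y.
congr Sup; apply/seteqP; split=> _ [[x y] xy <-]; exists (x, qstar y).
- exact: xy.
- by rewrite [LHS]pureE qstarK.
- by rewrite /= qstarK.
- by rewrite [RHS]pureE.
Qed.

Section GraphOf.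
Hypothesis (Qm : multiplicative) (Qs : semiopen).

Definition Q_mul_fhom : frameHom Q QQ.
Proof.
exists (radj mu0).
- exact: Qm.2.
- exact: right_adjointI (radjP (mu0_Sup Qs)).
- exact: right_adjoint1 (radjP (mu0_Sup Qs)).
Defined.

Lemma upsilon_rsided a : upsilon a *q \top <= upsilon a.
Proof. by case: Qs. Qed.

Definition upsilon_rs a : rsided := RSided (upsilon_rsided a).

Let upsilon_fhom := fhom_comp (tensor_copair upsilon_subproof) Q_mul_fhom.

Let upsilon_fhomE a : upsilon a = upsilon_fhom a.
Proof. exact: upsilonE. Qed.

Definition Q_unit_fhom : frameHom Q rsided.
Proof.
exists upsilon_rs.
- move=> S; apply: val_inj; rewrite /= upsilon_fhomE fhom_Sup image_comp.
  by congr Sup; apply: eq_imagel => a _; apply/esym/upsilon_fhomE.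
- by move=> a b; apply: val_inj; rewrite /= !upsilon_fhomE fhomI.
- by apply: val_inj; rewrite /= upsilon_fhomE fhom1 -(fhom1 rs_incl).
Defined.

Definition graph_of : locGraph := {|
  G0 := rsided;
  G1 := Q;
  gdom := LocMap rs_incl;
  gran := LocMap rs_star;
  gmul := LocMap Q_mul_fhom : locmap (pullback (LocMap rs_star) (LocMap rs_incl)) Q;
  gunit := LocMap Q_unit_fhom;
  ginv := LocMap qstar_fhom
|}.

Lemma graph_ofE : [/\ forall z, inv_im (gdom graph_of) z = rsval z,
  forall z, inv_im (gran graph_of) z = qstar (rsval z),
  forall a, inv_im (ginv graph_of) a = qstar a,
  forall a, inv_im (gmul graph_of) a = radj mu0 a &
  forall a, rsval (inv_im (gunit graph_of) a) = upsilon a].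
Proof. by split. Qed.

End GraphOf.

End QuantalFrame.

(* Main.v *)
Require Import Defs.
From mathcomp Require Import all_boot all_order.
From mathcomp Require Import classical_sets.

(** Every inverse image occurring in the groupoid laws is a frame homomorphism
    applied to the join [radj mu0 a] of the [pure x y] with [x *q y <= a], so
    each law compares joins indexed by such factorizations ([hom_mul_leP],
    [copair_mul_leP]).

    Associativity is then formal: both composites send [a] to the join of the
    [x (x) y (x) z] with [x *q y *q z <= a].  The argument stays with inverse
    images: tensoring [mu0] with an identity, to obtain a left adjoint of the
    multiplication paired with that identity, would call for [mu0] to commute
    with the action of the right-sided elements, which is the additional axiom
    of open quantal frames.

    The remaining laws come from the two halves of
    [Sup [set x | x *q qstar x *q x <= a] = a].
    - The inequality [x <= x *q qstar x *q x] gives [x <= x *q \top].  Together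
      with balancedness it shows that [x *q y <= z] forces
      [pure x y <= pure z \top] when [z] is right-sided, that is, the domain of
      a product is that of its first factor, and dually for the range
      ([radj_mu0_rsided], [radj_mu0_rsided_star]).
    - The implication from [x *q qstar x *q x <= a] to [x <= a] gives the unit
      laws: an element below one factor of [a] and below the unit part of the
      other satisfies this hypothesis ([upsilon_meetl], [upsilon_meetr]).
      Conversely each such [x] lies below the unit part of [x *q qstar x], and
      [a] is the join of these [x].
    The inverse laws restate the definition of [upsilon].

    The multiplication is semiopen because [mu0] is left adjoint to its inverse
    image.  If [Q] is open then [a |-> a *q \top] is left adjoint to the
    inclusion of the right-sided elements, and the open axiom applied to
    [\top] is the Frobenius identity for the domain map. *)

Set Implicit Arguments.
Unset Strict Implicit.
Unset Printing Implicit Defensive.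

Import Order.TTheory.
Local Open Scope classical_set_scope.
Local Open Scope order_scope.

(** * Triple products *)

Section SemiopenQuantalFrame.
Context {dQ : Order.disp_t} {Q : invQuantalFrameType dQ}.
Hypothesis Qs : semiopen Q.
Implicit Types (a b c x y : Q).

Local Notation QQ := (tensor (rs_star Q) (rs_incl Q)).

Lemma qstar_le a b : (qstar a <= qstar b) = (a <= b).
Proof. by rewrite qstar_adj qstarK. Qed.

Lemma qstarI a b : qstar (a `&` b) = qstar a `&` qstar b.
Proof. exact: (fhomI (qstar_fhom Q)). Qed.

Lemma qstar1 : qstar (\top : Q) = \top.
Proof. exact: (fhom1 (qstar_fhom Q)). Qed.

Lemma le_mulr1 a : a <= a *q \top.
Proof.
by apply: le_trans (mulr_le_semiopen a Qs) _; rewrite -qmulA qmul_le ?lex1.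
Qed.

Lemma le_mul1l a : a <= \top *q a.
Proof. by apply: le_trans (mulr_le_semiopen a Qs) _; rewrite qmul_le ?lex1. Qed.

(** This is the form in which semiopenness yields upper bounds: the elements
    over which the join in the axiom ranges are all below [a]. *)
Lemma le_of_mulr_le a x y w :
  w <= x -> qstar w <= y -> x *q y *q w <= a -> w <= a.
Proof.
move=> wx wy le_a; have [_ _ /(_ a) <-] := Qs; apply: Sup_ub => /=.
by apply: le_trans le_a; rewrite !qmul_le.
Qed.

Lemma rsided_mul1 a : (a *q \top) *q \top <= a *q \top.
Proof. by rewrite -qmulA qmul_le ?lex1. Qed.

(** * Factorizations *)

(** The free meetand [c] allows the lemma to be applied to one component of a
    pairing while the other stays fixed. *)
Lemma hom_mul_leP dX (X : frameType dX) (k : frameHom QQ X) a (c w : X) :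
  k (radj (@mu0 _ Q) a) `&` c <= w <->
  (forall x y, x *q y <= a -> k (pure _ _ x y) `&` c <= w).
Proof.
rewrite (radj_mu0E a Qs) fhom_Sup image_comp meetC meet_Sup image_comp Sup_leP.
split=> [h x y xy|h _ [[x y] xy <-] /=]; last by rewrite meetC; apply: h.
by rewrite meetC; apply: h; exists (x, y).
Qed.

Section Copair.
Context {dX : Order.disp_t} {X : frameType dX} (p q : frameHom Q X).
Hypothesis pq : forall z, p (rs_star Q z) = q (rs_incl Q z).

Lemma copair_pure x y : tensor_copair pq (pure _ _ x y) = p x `&` q y.
Proof. exact: tensor_lift_pure (copair_balanced pq) x y. Qed.

Lemma copair_mul_leP a (w : X) :
  tensor_copair pq (radj (@mu0 _ Q) a) <= w <->
  (forall x y, x *q y <= a -> p x `&` q y <= w).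
Proof.
rewrite -[tensor_copair pq _]meetx1 hom_mul_leP.
by split=> h x y /h; rewrite copair_pure meetx1.
Qed.

End Copair.

Lemma radj_mu0_leP a (U : QQ) :
  radj (@mu0 _ Q) a <= U <-> (forall x y, x *q y <= a -> pure _ _ x y <= U).
Proof.
rewrite -[radj _ _]meetx1 (hom_mul_leP (fhom_id _)).
by split=> h x y /h; rewrite meetx1.
Qed.

Lemma le_radj_mu0 x y a : x *q y <= a -> pure _ _ x y <= radj (@mu0 _ Q) a.
Proof. by rewrite -(radjP (mu0_Sup Qs)) mu0_pure. Qed.

(** Composability lets the first factor be cut down to the part [x'] whose range
    lies in the domain of [y]; balancedness then computes [x' *q \top]. *)
Lemma radj_mu0_rsided (z : rsided Q) :
  radj (@mu0 _ Q) (rsval z) = pure _ _ (rsval z) \top.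
Proof.
have [bal _ _] := Qs.
apply/le_anti/andP; split; last by apply: le_radj_mu0; apply: rsvalP.
apply/radj_mu0_leP => x y xy; pose w := RSided (rsided_mul1 y).
have -> : pure (rs_star Q) (rs_incl Q) x y
    = pure _ _ (x `&` rs_star Q w) y.
  by rewrite pure_balanced /= (meet_idPr (le_mulr1 y)).
apply/pure_leP; apply: (@tset_down _ _ _ _ _ _ _ _ _ (rsval z) \top);
  [|exact: lex1|by apply/pure_leP; apply: lexx].
apply: le_trans (le_mulr1 _) _; rewrite /= qstarM qstar1 -bal meetx1 qmulA.
by apply: le_trans (rsvalP z); rewrite qmul_le.
Qed.

(** The mirror image: here the second factor is cut down to the part whose
    domain lies in the range of [x]. *)
Lemma radj_mu0_rsided_star (z : rsided Q) :
  radj (@mu0 _ Q) (qstar (rsval z)) = pure _ _ \top (qstar (rsval z)).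
Proof.
have [bal _ _] := Qs.
have zl : \top *q qstar (rsval z) <= qstar (rsval z).
  by rewrite -{1}qstar1 -qstarM qstar_le; apply: rsvalP.
apply/le_anti/andP; split; last exact: le_radj_mu0.
apply/radj_mu0_leP => x y xy; pose w := RSided (rsided_mul1 (qstar x)).
have -> : pure (rs_star Q) (rs_incl Q) x y
    = pure _ _ x (rs_incl Q w `&` y).
  by rewrite -pure_balanced /= qstarM qstar1 qstarK (meet_idPl (le_mul1l x)).
apply/pure_leP; apply: (@tset_down _ _ _ _ _ _ _ _ _ \top (qstar (rsval z)));
  [exact: lex1| |by apply/pure_leP; apply: lexx].
apply: le_trans (le_mul1l _) _; rewrite /= bal qstarK meet1x -qmulA.
by apply: le_trans zl; rewrite qmul_le.
Qed.

(** * Units *)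

Lemma upsilon_leP a b :
  upsilon a <= b <-> (forall x y, x *q qstar y <= a -> x `&` y <= b).
Proof.
rewrite Sup_leP; split=> [h x y xy|h _ [[x y] xy <-]]; last exact: h.
by apply: h; exists (x, y).
Qed.

Lemma le_upsilon a x y : x *q qstar y <= a -> x `&` y <= upsilon a.
Proof. by apply: (upsilon_leP a (upsilon a)).1. Qed.

Lemma upsilon_rsval (z : rsided Q) : upsilon (rsval z) = rsval z.
Proof.
apply/le_anti/andP; split.
  apply/upsilon_leP => x y xy.
  apply: (@le_of_mulr_le _ x (qstar y)); rewrite ?qstar_le ?leIl ?leIr//.
  by apply: le_trans (rsvalP z); rewrite qmul_le ?lex1.
by rewrite -{1}[rsval z]meetx1 le_upsilon // qstar1 rsvalP.
Qed.

Lemma upsilon_star a : upsilon (qstar a) = upsilon a.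
Proof.
suff h b : upsilon (qstar b) <= upsilon b.
  by apply/le_anti; rewrite h -{1}[a]qstarK h.
apply/upsilon_leP => x y xy; rewrite meetC le_upsilon //.
by rewrite -qstar_le qstarM qstarK.
Qed.

(** Below [upsilon x] and [y] lie the [w := y `&` (s `&` t)] with
    [s *q qstar t <= x], and [w *q qstar w *q w <= s *q qstar t *q y <= a]. *)
Lemma upsilon_meetl x y a : x *q y <= a -> upsilon x `&` y <= a.
Proof.
move=> xy; rewrite meetC meet_Sup Sup_leP => _ [_ [[s t] /= st <-] <-].
apply: (@le_of_mulr_le _ s (qstar t)).
- by rewrite (le_trans (leIr _ _)) ?leIl.
- by rewrite qstar_le (le_trans (leIr _ _)) ?leIr.
- by apply: le_trans xy; rewrite qmul_le ?leIl.
Qed.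

Lemma upsilon_meetr x y a : x *q y <= a -> x `&` qstar (upsilon y) <= a.
Proof.
move=> xy; rewrite -qstar_le qstarI qstarK -upsilon_star meetC.
by apply: upsilon_meetl; rewrite -qstarM qstar_le.
Qed.

Lemma le_upsilon_mul_star x : x <= upsilon (x *q qstar x).
Proof. by rewrite -{1}[x]meetxx le_upsilon. Qed.

(** Each such [x] provides the factorizations [(x *q qstar x) *q x] and
    [x *q (qstar x *q x)] of an element below [a]; up to the involution the
    unit part of the bracketed factor is above [x] ([le_upsilon_mul_star]). *)
Lemma semiopen_le a b :
  (forall x, x *q qstar x *q x <= a -> x <= b) -> a <= b.
Proof. by have [_ _ /(_ a) {2}<-] := Qs; move=> h; apply: Sup_le. Qed.

End SemiopenQuantalFrame.

(** * The groupoid *)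

Section GroupoidOf.
Context {dQ : Order.disp_t} {Q : invQuantalFrameType dQ}.
Variables (Qm : multiplicative Q) (Qs : semiopen Q).
Local Notation G := (graph_of Qm Qs).
Implicit Types (a b c x y : Q).

Lemma graph_of_dm : gdom G \oL gmul G = gdom G \oL pr1.
Proof. by apply: locmap_eq => z; apply: radj_mu0_rsided. Qed.

Lemma graph_of_rm : gran G \oL gmul G = gran G \oL pr2.
Proof. by apply: locmap_eq => z; apply: radj_mu0_rsided_star. Qed.

Lemma graph_of_du : gdom G \oL gunit G = loc_id _.
Proof. by apply: locmap_eq => z; apply/val_inj/upsilon_rsval. Qed.

Lemma graph_of_ru : gran G \oL gunit G = loc_id _.
Proof.
apply: locmap_eq => z; apply: val_inj.
by rewrite /= upsilon_star upsilon_rsval.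
Qed.

Lemma graph_of_di : gdom G \oL ginv G = gran G.
Proof. exact: locmap_eq. Qed.

Lemma graph_of_ri : gran G \oL ginv G = gdom G.
Proof. by apply: locmap_eq => z; apply: qstarK. Qed.

(** On inverse images, both sides are the join of the
    [pure (pure x y) z] with [x *q y *q z <= a]. *)
Lemma graph_of_assoc :
  gmul G \oL pb_pair (mulx1_compat graph_of_rm) =
  gmul G \oL pb_pair (x1mul_compat graph_of_dm).
Proof.
apply: locmap_eq => a; apply: le_eqP => W.
(* [triple x y z] is the element of the frame of [G3] usually written
   [x (x) y (x) z]. *)
pose triple x y z := inv_im (fst3 G) (inv_im pr1 x) `&`
  (inv_im (fst3 G) (inv_im pr2 y) `&` inv_im (trd3 G) z).
have pureE x y : pure (rs_star Q) (rs_incl Q) x y =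
    inv_im (pr1 : locmap (pullback (gran G) (gdom G)) _) x `&`
    inv_im (pr2 : locmap (pullback (gran G) (gdom G)) _) y.
  by rewrite /= -pureI meetx1 meet1x.
apply: (iff_trans (B := forall x y z, x *q y *q z <= a -> triple x y z <= W)).
  apply: (iff_trans (copair_mul_leP Qs _ a W)).
  split=> h.
    move=> x y z xyz; rewrite /triple meetA -fhomI -pureE.
    exact: ((hom_mul_leP Qs (inv_im (fst3 G)) (x *q y) _ W).1 (h _ _ xyz)).
  move=> w z wz.
  apply/(hom_mul_leP Qs (inv_im (fst3 G)) w _ W) => x y xy.
  rewrite pureE fhomI -meetA; apply: h.
  by apply: le_trans wz; rewrite qmul_le.
apply: iff_sym; apply: (iff_trans (copair_mul_leP Qs _ a W)).
have snd3E y z : inv_im (snd3 G) (pure (rs_star Q) (rs_incl Q) y z) =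
    inv_im (fst3 G) (inv_im pr2 y) `&` inv_im (trd3 G) z.
  exact: copair_pure.
split=> h.
  move=> x y z xyz; rewrite /triple -snd3E meetC.
  apply: (hom_mul_leP Qs (inv_im (snd3 G)) (y *q z) _ W).1 => //.
  by rewrite meetC; apply: h; rewrite qmulA.
move=> x w xw; rewrite meetC.
apply/(hom_mul_leP Qs (inv_im (snd3 G)) w _ W) => y z yz.
rewrite snd3E meetC; apply: h.
by apply: le_trans xw; rewrite -qmulA qmul_le.
Qed.

Lemma graph_of_unitl : gmul G \oL pb_pair (unitl_compat graph_of_ru) = loc_id _.
Proof.
apply: locmap_eq => a; apply/le_anti/andP; split.
  by apply/(copair_mul_leP Qs) => x y; apply: upsilon_meetl.
apply: (semiopen_le Qs) => x xa.
apply: le_trans ((copair_mul_leP Qs _ a _).1 (lexx _) _ _ xa).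
by rewrite lexI lexx andbT; apply: le_upsilon_mul_star.
Qed.

Lemma graph_of_unitr : gmul G \oL pb_pair (unitr_compat graph_of_du) = loc_id _.
Proof.
apply: locmap_eq => a; apply/le_anti/andP; split.
  by apply/(copair_mul_leP Qs) => x y; apply: upsilon_meetr.
apply: (semiopen_le Qs) => x; rewrite -qmulA => xa.
apply: le_trans ((copair_mul_leP Qs _ a _).1 (lexx _) _ _ xa).
rewrite lexI lexx /= -qstar_adj.
by have := le_upsilon_mul_star (qstar x); rewrite qstarK.
Qed.

(** Replacing [y] by [qstar y] turns the join of the [x `&` qstar y] with
    [x *q y <= a] into the one that defines [upsilon a]. *)
Lemma graph_of_invr :
  gmul G \oL pb_pair (invr_compat graph_of_di) = gunit G \oL gdom G.
Proof.
by apply: locmap_eq => a; apply/esym; apply: upsilonE.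
Qed.

Lemma graph_of_invl :
  gmul G \oL pb_pair (invl_compat graph_of_ri) = gunit G \oL gran G.
Proof.
apply: locmap_eq => a; rewrite [RHS]/=; apply: le_eqP => w.
rewrite qstar_adj; apply: (iff_trans (copair_mul_leP Qs _ a w)).
apply: (iff_trans _ (iff_sym (upsilon_leP _ _))); split=> h x y xy.
  by rewrite -qstar_adj qstarI; apply: h.
by rewrite -[y]qstarK -qstarI /= qstar_adj; apply: h; rewrite qstarK.
Qed.

Lemma graph_of_groupoid : localic_groupoid G.
Proof.
exact: LocalicGroupoid graph_of_assoc graph_of_unitl graph_of_unitr
  graph_of_invr graph_of_invl.
Qed.

Lemma graph_of_mul_semiopen : loc_semiopen (gmul G).
Proof. by exists (@mu0 _ Q); apply: radjP (mu0_Sup Qs). Qed.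

Lemma graph_of_dom_open : qopen Q -> loc_open (gdom G).
Proof.
move=> [_ Qo]; exists (fun a => RSided (rsided_mul1 a)); split=> [a z|a z].
  rewrite rs_le /=; apply/idP/idP; first exact: le_trans (le_mulr1 Qs a).
  by move=> az; apply: le_trans (rsvalP z); rewrite qmul_le.
by apply: val_inj; rewrite /= (semiopen_rsided z Qs) Qo.
Qed.

End GroupoidOf.

Theorem theorem2p47 (d : Order.disp_t) (Q : invQuantalFrameType d)
    (Qm : multiplicative Q) (Qs : semiopen Q) :
  quantal_groupoid (graph_of Qm Qs) /\
  (qopen Q -> open_groupoid (graph_of Qm Qs)).
Proof.
have QG := graph_of_groupoid Qm Qs.
split; first by split=> //; apply: graph_of_mul_semiopen.
by move=> Qo; split=> //; apply: graph_of_dom_open.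
Qed.
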